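(* Let $(E,(O_n)_{n\in\mathbb{N}},\ll)$ be an effective approximation space. Then, with all effective classes taken relative to the enumeration $(O_n)_{n\in\mathbb{N}}$, $F_\sigma(E)\cap G_\delta(E)\subseteq\bigcup_{\alpha<\omega_1^{CK}}\mathrm{D}_\alpha(E)\subseteq\Delta^0_2(E)$. In particular, if $F_\sigma(E)\cap G_\delta(E)=\Delta^0_2(E)$ then $\bigcup_{\alpha<\omega_1^{CK}}\mathrm{D}_\alpha(E)=\Delta^0_2(E)$.
   Context: Approximation relation: a binary relation $\ll$ on a topological basis $\mathcal{B}$ of $E$ such that for all $U,V,T\in\mathcal{B}$: (1) $U\ll V\Rightarrow V\subseteq U$; (2) $U\subseteq T$ and $U\ll V$ imply $T\ll V$; (3) for every $x\in U$ there is $W\in\mathcal{B}$ with $x\in W$, $U\ll W$; (4) every sequence $(U_i)$ in $\mathcal{B}$ with $U_i\ll U_{i+1}$ for all $i$ has $\bigcap_iU_i\neq\emptyset$. An effective approximation space is a triple $(E,(O_n)_{n},\ll)$ where $(O_n)_{n\in\mathbb{N}}$ enumerates (not necessarily injectively) a topological basis $\mathcal{B}$ of $E$, $\ll$ is an approximation relation on $\mathcal{B}$, and $\{(i,j):O_i\ll O_j\}$ is computably enumerable. Effective classes relative to $(O_n)$: a sequence $(X_n)_{n}$ of subsets of $E$ is uniformly $\Sigma^0_1$ if there is a c.e. $W\subseteq\mathbb{N}^2$ with $X_n=\bigcup_{i:(n,i)\in W}O_i$. $G_\delta(E)$: sets $\bigcap_nX_n$ with $(X_n)$ uniformly $\Sigma^0_1$;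 $F_\sigma(E)$: complements of $G_\delta(E)$ sets. $\Sigma^0_2(E)$: sets $\bigcup_n(X_n\setminus Y_n)$ with $(X_n),(Y_n)$ uniformly $\Sigma^0_1$; $\Pi^0_2(E)$: complements; $\Delta^0_2(E)=\Sigma^0_2(E)\cap\Pi^0_2(E)$. $\omega_1^{CK}$: the least non-computable ordinal. Parity: ordinal $\lambda+n$ ($\lambda$ zero or limit, $n<\omega$) has the parity of $n$; $\beta\sim\alpha$ means same parity. For $1\le\alpha<\omega_1^{CK}$, $\mathrm{D}_\alpha(E)$ is the class of sets $X$ for which there are a computable well-order $\preceq$ of order type $\alpha$ on $\mathbb{N}$ or on a finite initial segment $N$ of $\mathbb{N}$, with isomorphism $\varphi$ onto $\alpha$ such that $\{n:\varphi(n)\not\sim\alpha\}$ is computable, and a uniformly $\Sigma^0_1$ sequence $(X_n)_{n\in N}$ with $X=\bigcup_{p:\varphi(p)\not\sim\alpha}\big(X_p\setminus\bigcup_{q:\varphi(q)<\varphi(p)}X_q\big)$. *)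

(* Defs.v *)
From Stdlib Require Import Arith Cantor.

Definition pair (a b : nat) : nat := Cantor.to_nat (a, b).
Definition unpair1 (n : nat) : nat := fst (Cantor.of_nat n).
Definition unpair2 (n : nat) : nat := snd (Cantor.of_nat n).

Inductive prf : Type :=
| PZero : prf
| PSucc : prf
| PId   : prf
| PFst  : prf
| PSnd  : prf
| PPair : prf -> prf -> prf
| PComp : prf -> prf -> prf
| PRec  : prf -> prf -> prf
| PMu   : prf -> prf.

Inductive eval : prf -> nat -> nat -> Prop :=
| ev_zero x : eval PZero x 0
| ev_succ x : eval PSucc x (S x)
| ev_id x : eval PId x x
| ev_fst x : eval PFst x (unpair1 x)
| ev_snd x : eval PSnd x (unpair2 x)
| ev_pair f g x a b : eval f x a -> eval g x b -> eval (PPair f g) x (pair a b)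
| ev_comp f g x y z : eval g x y -> eval f y z -> eval (PComp f g) x z
| ev_rec f g x r : eval_rec f g (unpair1 x) (unpair2 x) r -> eval (PRec f g) x r
| ev_mu f x n : eval f (pair n x) 0 ->
    (forall m, m < n -> exists k, eval f (pair m x) (S k)) -> eval (PMu f) x n
with eval_rec : prf -> prf -> nat -> nat -> nat -> Prop :=
| er_zero f g z r : eval f z r -> eval_rec f g 0 z r
| er_succ f g n z r r' : eval_rec f g n z r ->
    eval g (pair n (pair r z)) r' -> eval_rec f g (S n) z r'.

Definition computable_set (A : nat -> Prop) : Prop :=
  exists c : prf, forall x, (A x -> eval c x 1) /\ (~ A x -> eval c x 0).

Definition ce_set (A : nat -> Prop) : Prop :=
  exists c : prf, forall x, A x <-> exists y, eval c x y.

Definition computable_rel (R : nat -> nat -> Prop) : Prop :=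
  computable_set (fun p => R (unpair1 p) (unpair2 p)).
Definition ce_rel (R : nat -> nat -> Prop) : Prop :=
  ce_set (fun p => R (unpair1 p) (unpair2 p)).

Definition subset {E : Type} (U V : E -> Prop) : Prop := forall x, U x -> V x.

Definition is_basis {E : Type} (O : nat -> E -> Prop) : Prop :=
  (forall x : E, exists n, O n x) /\
  (forall i j (x : E), O i x -> O j x ->
     exists k, O k x /\ subset (O k) (O i) /\ subset (O k) (O j)).

Definition approximation_relation {E : Type} (O : nat -> E -> Prop)
    (ll : (E -> Prop) -> (E -> Prop) -> Prop) : Prop :=
  (forall i j, ll (O i) (O j) -> subset (O j) (O i)) /\
  (forall i j t, subset (O i) (O t) -> ll (O i) (O j) -> ll (O t) (O j)) /\
  (forall i (x : E), O i x -> exists w, O w x /\ ll (O i) (O w)) /\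
  (forall u : nat -> nat, (forall i, ll (O (u i)) (O (u (S i)))) ->
     exists x : E, forall i, O (u i) x).

Definition effective_approximation_space (E : Type) (O : nat -> E -> Prop)
    (ll : (E -> Prop) -> (E -> Prop) -> Prop) : Prop :=
  is_basis O /\ approximation_relation O ll /\
  ce_rel (fun i j => ll (O i) (O j)).

Definition unif_Sigma01 {E : Type} (O : nat -> E -> Prop) (X : nat -> E -> Prop) : Prop :=
  exists W : nat -> nat -> Prop, ce_rel W /\
    forall n x, X n x <-> exists i, W n i /\ O i x.

Definition Gdelta {E : Type} (O : nat -> E -> Prop) (A : E -> Prop) : Prop :=
  exists X, unif_Sigma01 O X /\ forall x, A x <-> forall n, X n x.

Definition Fsigma {E : Type} (O : nat -> E -> Prop) (A : E -> Prop) : Prop :=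
  exists B, Gdelta O B /\ forall x, A x <-> ~ B x.

Definition Sigma02 {E : Type} (O : nat -> E -> Prop) (A : E -> Prop) : Prop :=
  exists X Y, unif_Sigma01 O X /\ unif_Sigma01 O Y /\
    forall x, A x <-> exists n, X n x /\ ~ Y n x.

Definition Pi02 {E : Type} (O : nat -> E -> Prop) (A : E -> Prop) : Prop :=
  exists B, Sigma02 O B /\ forall x, A x <-> ~ B x.

Definition Delta02 {E : Type} (O : nat -> E -> Prop) (A : E -> Prop) : Prop :=
  Sigma02 O A /\ Pi02 O A.

Definition in_dom (bound : option nat) (n : nat) : Prop :=
  match bound with None => True | Some k => n < k end.

Definition well_order_on (D : nat -> Prop) (le : nat -> nat -> Prop) : Prop :=
  (forall a, D a -> le a a) /\
  (forall a b, D a -> D b -> le a b -> le b a -> a = b) /\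
  (forall a b c, D a -> D b -> D c -> le a b -> le b c -> le a c) /\
  (forall a b, D a -> D b -> le a b \/ le b a) /\
  (forall S : nat -> Prop, (forall a, S a -> D a) -> (exists a, S a) ->
     exists m, S m /\ forall a, S a -> le m a).

Definition lt_on (D : nat -> Prop) (le : nat -> nat -> Prop) (a b : nat) : Prop :=
  D a /\ D b /\ le a b /\ a <> b.

Definition imm_pred (D : nat -> Prop) (le : nat -> nat -> Prop) (q p : nat) : Prop :=
  lt_on D le q p /\ ~ exists r, lt_on D le q r /\ lt_on D le r p.

(* fin_part D le p n : the ordinal φ(p) of p is λ + n with λ zero or limit *)
Inductive fin_part (D : nat -> Prop) (le : nat -> nat -> Prop) : nat -> nat -> Prop :=
| fp_base p : D p -> (~ exists q, imm_pred D le q p) -> fin_part D le p 0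
| fp_step q p n : imm_pred D le q p -> fin_part D le q n -> fin_part D le p (S n).

(* fin_part_type D le n : the order type α of (D, le) is λ + n, λ zero or limit
   (α = φ(m)+1 if there is a maximum m, and α is a limit otherwise). *)
Definition fin_part_type (D : nat -> Prop) (le : nat -> nat -> Prop) (n : nat) : Prop :=
  (exists m k, D m /\ (forall a, D a -> le a m) /\ fin_part D le m k /\ n = S k) \/
  ((~ exists m, D m /\ forall a, D a -> le a m) /\ n = 0).

Definition parity_differs (D : nat -> Prop) (le : nat -> nat -> Prop) (p : nat) : Prop :=
  D p /\ exists n m, fin_part D le p n /\ fin_part_type D le m /\ Nat.even n <> Nat.even m.

(* A ∈ ⋃_{1 ≤ α < ω1^CK} D_α(E): there are a computable well-order le of
   some order type α ≥ 1 on ℕ or on a finite initial segment, with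
   {n : φ(n) ≁ α} computable, and a uniformly Σ⁰₁ sequence (X_n) with
   A = ⋃_{p : φ(p) ≁ α} (X_p \ ⋃_{φ(q) < φ(p)} X_q). *)
Definition D_union {E : Type} (O : nat -> E -> Prop) (A : E -> Prop) : Prop :=
  exists (bound : option nat) (le : nat -> nat -> Prop) (X : nat -> E -> Prop),
    let D := in_dom bound in
    (exists a, D a) /\
    well_order_on D le /\
    computable_rel (fun a b => D a /\ D b /\ le a b) /\
    computable_set (parity_differs D le) /\
    unif_Sigma01 O X /\
    forall x, A x <-> exists p, parity_differs D le p /\ X p x /\
                      ~ exists q, lt_on D le q p /\ X q x.

(* Main.v *)
(* For [A] in F_sigma ∩ G_delta write [A] and its complement as ⋂_n U_n and ⋂_n V_n, and
   interleave: Z_(2n) = U_n, Z_(2n+1) = V_n. Consider the tree of finite sequences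
   O_(i_0) << … << O_(i_m) with O_(i_(k+1)) ⊆ Z_k. An infinite branch would give a point in
   every Z_k, so the tree is well-founded and its Kleene-Brouwer order is a well-order. For
   a point [x], the least sequence whose last open set contains [x] cannot be extended
   around [x], so [x] is not in Z_m; hence [x] belongs to [A] exactly when m is odd. Annotating
   the sequences with witnesses of the c.e. conditions makes the tree computable, and
   multiplying the order by ω allows every set to be put at a place of the parity wanted. *)

Require Import Defs.
From Stdlib Require Import Arith Lia List Bool Classical ClassicalEpsilon.

(** * Pairing of natural numbers *)

Arguments pair : simpl never.
Arguments unpair1 : simpl never.
Arguments unpair2 : simpl never.

Lemma unpair1_pair a b : unpair1 (pair a b) = a.
Proof. unfold unpair1, pair. now rewrite Cantor.cancel_of_to. Qed.

Lemma unpair2_pair a b : unpair2 (pair a b) = b.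
Proof. unfold unpair2, pair. now rewrite Cantor.cancel_of_to. Qed.

Lemma pair_unpair n : pair (unpair1 n) (unpair2 n) = n.
Proof.
  unfold unpair1, unpair2, pair. rewrite <- surjective_pairing.
  apply Cantor.cancel_to_of.
Qed.

Lemma unpair2_le n : unpair2 n <= n.
Proof.
  rewrite <- (pair_unpair n) at 2. unfold pair.
  pose proof (Cantor.to_nat_non_decreasing (unpair1 n) (unpair2 n)). lia.
Qed.

Lemma le_pair_r a b : b <= pair a b.
Proof. pose proof (unpair2_le (pair a b)). rewrite unpair2_pair in H. exact H. Qed.

Lemma unpair_inj m n : unpair1 m = unpair1 n -> unpair2 m = unpair2 n -> m = n.
Proof. intros H1 H2. rewrite <- (pair_unpair m), <- (pair_unpair n). congruence. Qed.

#[local] Hint Rewrite unpair1_pair unpair2_pair : unpair.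

(** * Closure properties of computable functions *)

Definition computable_fun (f : nat -> nat) : Prop :=
  exists c, forall x, eval c x (f x).

Definition computable_fun2 (f : nat -> nat -> nat) : Prop :=
  computable_fun (fun p => f (unpair1 p) (unpair2 p)).

Lemma computable_ext f g :
  (forall x, f x = g x) -> computable_fun f -> computable_fun g.
Proof. intros H [c Hc]. exists c. intros x. rewrite <- H. apply Hc. Qed.

Lemma computable_id : computable_fun (fun x => x).
Proof. exists PId. intros; constructor. Qed.

Lemma computable_comp f g :
  computable_fun f -> computable_fun g -> computable_fun (fun x => f (g x)).
Proof.
  intros [c Hc] [d Hd]. exists (PComp c d). intros x. econstructor; eauto.
Qed.

Lemma computable_S f : computable_fun f -> computable_fun (fun x => S (f x)).
Proof. apply (computable_comp S). exists PSucc. constructor. Qed.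

Lemma computable_const k : computable_fun (fun _ => k).
Proof.
  induction k as [|k IH].
  - exists PZero. constructor.
  - now apply computable_S.
Qed.

Lemma computable_unpair1 f :
  computable_fun f -> computable_fun (fun x => unpair1 (f x)).
Proof. apply (computable_comp unpair1). exists PFst. constructor. Qed.

Lemma computable_unpair2 f :
  computable_fun f -> computable_fun (fun x => unpair2 (f x)).
Proof. apply (computable_comp unpair2). exists PSnd. constructor. Qed.

Lemma computable_pair f g :
  computable_fun f -> computable_fun g -> computable_fun (fun x => pair (f x) (g x)).
Proof.
  intros [c Hc] [d Hd]. exists (PPair c d). intros x. constructor; auto.
Qed.

Lemma computable_app2 h f g :
  computable_fun2 h -> computable_fun f -> computable_fun g ->
  computable_fun (fun x => h (f x) (g x)).
Proof.
  intros Hh Hf Hg.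
  apply computable_ext with
    (fun x => (fun p => h (unpair1 p) (unpair2 p)) (pair (f x) (g x))).
  - intros x. now autorewrite with unpair.
  - apply (computable_comp (fun p => h (unpair1 p) (unpair2 p))); trivial.
    now apply computable_pair.
Qed.

(** [PRec] hands its step the code of index, accumulator and parameter. The whole input, supplied
    through [PId], serves as parameter, so [g] and [h] may depend on [x]. *)
Lemma computable_nat_rec f g h :
  computable_fun f -> computable_fun g ->
  computable_fun
    (fun p => h (unpair1 p) (unpair1 (unpair2 p)) (unpair2 (unpair2 p))) ->
  computable_fun
    (fun x => nat_rect (fun _ => nat) (g x) (fun n r => h n r x) (f x)).
Proof.
  intros [cf Hf] [cg Hg] [ch Hh].
  exists (PComp (PRec cg ch) (PPair cf PId)). intros x.
  eapply ev_comp; [constructor; [apply Hf | constructor]|].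
  constructor. autorewrite with unpair.
  induction (f x) as [|n IH]; simpl.
  - constructor. apply Hg.
  - econstructor; [exact IH|].
    set (r := nat_rect _ _ _ n).
    specialize (Hh (pair n (pair r x))). now autorewrite with unpair in Hh.
Qed.

Lemma computable_case f g h :
  computable_fun f -> computable_fun g -> computable_fun2 h ->
  computable_fun (fun x => match f x with 0 => g x | S m => h m x end).
Proof.
  intros Hf Hg Hh.
  apply computable_ext with
    (fun x => nat_rect (fun _ => nat) (g x) (fun n _ => h n x) (f x)).
  - intros x. now destruct (f x).
  - apply (computable_nat_rec f g (fun n _ x => h n x)); trivial.
    apply (computable_app2 h); trivial;
      repeat first [apply computable_unpair1 | apply computable_unpair2
                   | apply computable_id].
Qed.

(** Goal-directed search. Facts about particular functions enter as hypotheses, which is why some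
    proofs pose them first; a [match] on numbers is recognized by second-order matching. *)
Ltac computable :=
  repeat first
    [ assumption
    | apply computable_const
    | apply computable_id
    | apply computable_S
    | apply computable_unpair1
    | apply computable_unpair2
    | apply computable_pair
    | match goal with
      | |- computable_fun2 _ => progress unfold computable_fun2
      | |- computable_fun (fun x => match @?f x with 0 => @?g x | S m => @?h x m end) =>
          apply (computable_case f g (fun m x => h x m)); cbv beta
      end
    | match goal with
      | H : computable_fun2 ?h |- computable_fun (fun x => ?h _ _) =>
          apply (computable_app2 h); [exact H| |]
      | H : computable_fun ?h |- computable_fun (fun x => ?h _) =>
          apply (computable_comp h); [exact H|]
      end ].

Lemma computable_pred f : computable_fun f -> computable_fun (fun x => pred (f x)).
Proof. intros Hf. unfold pred. computable. Qed.

Lemma computable_add : computable_fun2 Nat.add.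
Proof.
  apply computable_ext with (fun x =>
    nat_rect (fun _ => nat) (unpair2 x) (fun _ r => S r) (unpair1 x)).
  - intros x. induction (unpair1 x); simpl; congruence.
  - apply (computable_nat_rec _ _ (fun _ r _ => S r)); computable.
Qed.

Lemma computable_sub : computable_fun2 Nat.sub.
Proof.
  apply computable_ext with (fun x =>
    nat_rect (fun _ => nat) (unpair1 x) (fun _ r => pred r) (unpair2 x)).
  - intros x. induction (unpair2 x); simpl; [|rewrite IHn]; lia.
  - apply (computable_nat_rec _ _ (fun _ r _ => pred r)); computable.
    apply computable_pred. computable.
Qed.

Lemma computable_iter f n g :
  computable_fun f -> computable_fun n -> computable_fun g ->
  computable_fun (fun x => Nat.iter (n x) f (g x)).
Proof.
  intros Hf Hn Hg.
  apply (computable_nat_rec n g (fun _ r _ => f r)); computable.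
Qed.

(** * Decidable predicates *)

Definition computable_bool (b : nat -> bool) : Prop :=
  computable_fun (fun x => Nat.b2n (b x)).

Lemma computable_if b f g :
  computable_bool b -> computable_fun f -> computable_fun g ->
  computable_fun (fun x => if b x then f x else g x).
Proof.
  intros Hb Hf Hg.
  apply computable_ext with
    (fun x => match Nat.b2n (b x) with 0 => g x | S _ => f x end).
  - intros x. now destruct (b x).
  - unfold computable_bool in Hb. computable.
Qed.

Lemma computable_leb f g :
  computable_fun f -> computable_fun g -> computable_bool (fun x => f x <=? g x).
Proof.
  intros Hf Hg. pose proof computable_sub.
  apply computable_ext with (fun x => match f x - g x with 0 => 1 | S _ => 0 end).
  - intros x. destruct (Nat.leb_spec (f x) (g x)); simpl.
    + now replace (f x - g x) with 0 by lia.
    + destruct (f x - g x) eqn:E; [lia | reflexivity].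
  - computable.
Qed.

Lemma computable_andb b c :
  computable_bool b -> computable_bool c -> computable_bool (fun x => b x && c x).
Proof.
  intros Hb Hc.
  apply computable_ext with (fun x => if b x then Nat.b2n (c x) else 0).
  - intros x. now destruct (b x).
  - apply computable_if; trivial. computable.
Qed.

Lemma computable_orb b c :
  computable_bool b -> computable_bool c -> computable_bool (fun x => b x || c x).
Proof.
  intros Hb Hc.
  apply computable_ext with (fun x => if b x then 1 else Nat.b2n (c x)).
  - intros x. now destruct (b x).
  - apply computable_if; trivial. computable.
Qed.

Lemma computable_ltb f g :
  computable_fun f -> computable_fun g -> computable_bool (fun x => f x <? g x).
Proof. intros Hf Hg. apply computable_leb; computable. Qed.

Lemma computable_eqb f g :
  computable_fun f -> computable_fun g -> computable_bool (fun x => f x =? g x).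
Proof.
  intros Hf Hg.
  apply computable_ext with (fun x => Nat.b2n ((f x <=? g x) && (g x <=? f x))).
  - intros x. f_equal.
    destruct (Nat.leb_spec (f x) (g x)), (Nat.leb_spec (g x) (f x)),
      (Nat.eqb_spec (f x) (g x)); simpl; lia.
  - apply computable_andb; apply computable_leb; trivial.
Qed.

Lemma computable_odd f :
  computable_fun f -> computable_bool (fun x => Nat.odd (f x)).
Proof.
  intros Hf.
  apply computable_ext with (fun x =>
    nat_rect (fun _ => nat) 0 (fun _ r => match r with 0 => 1 | S _ => 0 end) (f x)).
  - intros x. induction (f x) as [|n IH]; [reflexivity|].
    rewrite Nat.odd_succ, <- Nat.negb_odd. simpl. rewrite IH.
    now destruct (Nat.odd n).
  - apply (computable_nat_rec f _ (fun _ r _ => match r with 0 => 1 | S _ => 0 end));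
      computable.
Qed.

Lemma computable_set_bool (A : nat -> Prop) b :
  computable_bool b -> (forall x, A x <-> b x = true) -> computable_set A.
Proof.
  intros [c Hc] H. exists c. intros x. specialize (Hc x). rewrite H.
  destruct (b x); split; intros E; trivial; now try contradiction E.
Qed.

(** * Evaluation with bounded search *)

(* [run c s x] is [0] while undefined, [S y] once [c] is found to map [x] to [y]; the fuel
   [s] only bounds the unbounded searches, so that [run c] is itself computable. *)
Fixpoint run (c : prf) (s x : nat) : nat :=
  match c with
  | PZero => 1
  | PSucc => S (S x)
  | PId => S x
  | PFst => S (unpair1 x)
  | PSnd => S (unpair2 x)
  | PPair f g =>
      match run f s x with
      | 0 => 0
      | S a => match run g s x with 0 => 0 | S b => S (pair a b) end
      end
  | PComp f g => match run g s x with 0 => 0 | S y => run f s y end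
  | PRec f g =>
      nat_rect (fun _ => nat) (run f s (unpair2 x))
        (fun n r => match r with
                    | 0 => 0
                    | S r => run g s (pair n (pair r (unpair2 x)))
                    end)
        (unpair1 x)
  | PMu f =>
      (* search state: [0] still searching, [1] diverged, [S (S m)] zero found at [m] *)
      pred (nat_rect (fun _ => nat) 0
        (fun m t => match t with
                    | 0 => match run f s (pair m x) with
                           | 0 => 1
                           | S k => match k with 0 => S (S m) | S _ => 0 end
                           end
                    | S u => S u
                    end) s)
  end.

(** The code stays outside the computation: each [run c] gets its own program, built by induction on
    [c]. *)
Lemma computable_run c : computable_fun2 (run c).
Proof.
  induction c; simpl; computable.
  - apply (computable_nat_rec (fun x => unpair1 (unpair2 x))
      (fun x => run c1 (unpair1 x) (unpair2 (unpair2 x)))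
      (fun n r x => match r with
         | 0 => 0
         | S r => run c2 (unpair1 x) (pair n (pair r (unpair2 (unpair2 x))))
         end)); computable.
  - apply computable_pred.
    apply (computable_nat_rec unpair1 (fun _ => 0)
      (fun m t x => match t with
         | 0 => match run c (unpair1 x) (pair m (unpair2 x)) with
                | 0 => 1
                | S k => match k with 0 => S (S m) | S _ => 0 end
                end
         | S u => S u
         end)); computable.
Qed.

(** Only unbounded search is delicate: there, more fuel changes both the evaluations and the number
    of rounds. *)
Lemma run_mono c s s' x y : s <= s' -> run c s x = S y -> run c s' x = S y.
Proof.
  intros Hs. revert x y.
  induction c as [ | | | | |f IHf g IHg|f IHf g IHg|f IHf g IHg|f IHf];
    simpl; intros x y H; trivial.
  - destruct (run f s x) as [|a] eqn:Ef; [discriminate|].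
    destruct (run g s x) as [|b] eqn:Eg; [discriminate|].
    now rewrite (IHf _ _ Ef), (IHg _ _ Eg).
  - destruct (run g s x) as [|b] eqn:Eg; [discriminate|].
    rewrite (IHg _ _ Eg). auto.
  - revert y H. induction (unpair1 x) as [|n IH]; simpl; intros y H; auto.
    destruct (nat_rect _ _ _ n) as [|r] eqn:E in H; [discriminate|].
    rewrite (IH _ E). auto.
  - set (step s := fun m t : nat => match t with
        | 0 => match run f s (pair m x) with
               | 0 => 1
               | S k => match k with 0 => S (S m) | S _ => 0 end
               end
        | S u => S u
        end).
    fold (step s) in H. fold (step s').
    destruct (nat_rect _ 0 (step s) s) as [|[|n]] eqn:E; try discriminate.
    simpl in H. injection H as <-.
    (* Round by round, both searches agree as long as the one with less fuel has not reached the
       diverged state [1]. *)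
    assert (Hagree : forall k, nat_rect (fun _ => nat) 0 (step s) k <> 1 ->
      nat_rect (fun _ => nat) 0 (step s') k = nat_rect (fun _ => nat) 0 (step s) k).
    { induction k as [|k IH]; simpl; trivial.
      destruct (nat_rect _ 0 (step s) k) as [|u] eqn:Ek; intros Hk.
      - rewrite IH by discriminate. simpl in *.
        destruct (run f s (pair k x)) as [|v] eqn:Ev; [congruence|].
        now rewrite (IHf _ _ Ev).
      - now rewrite IH by exact Hk. }
    (* A found zero is an absorbing state, so the extra rounds keep it. *)
    assert (Hstay : forall d, nat_rect (fun _ => nat) 0 (step s') (d + s) = S (S n)).
    { induction d as [|d IH]; simpl.
      - rewrite Hagree; congruence.
      - now rewrite IH. }
    specialize (Hstay (s' - s)). replace (s' - s + s) with s' in Hstay by lia.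
    now rewrite Hstay.
Qed.

Lemma run_sound c s x y : run c s x = S y -> eval c x y.
Proof.
  revert x y.
  induction c as [ | | | | |f IHf g IHg|f IHf g IHg|f IHf g IHg|f IHf];
    simpl; intros x y H; try (injection H as <-; constructor).
  - destruct (run f s x) as [|a] eqn:Ef; [discriminate|].
    destruct (run g s x) as [|b] eqn:Eg; [discriminate|].
    injection H as <-. constructor; auto.
  - destruct (run g s x) as [|b] eqn:Eg; [discriminate|].
    econstructor; eauto.
  - constructor.
    revert y H. induction (unpair1 x) as [|n IH]; simpl; intros y H.
    + constructor. auto.
    + destruct (nat_rect _ _ _ n) as [|r] eqn:E in H; [discriminate|].
      econstructor; [apply IH; exact E | auto].
  - match type of H with pred (nat_rect _ _ ?st _) = _ => set (step := st) in H end.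
    (* State [0] certifies positive values at all arguments tried so far, and [S (S n)] certifies
       that [n] is the least zero; the diverged state promises nothing. *)
    assert (Hinv : forall k, match nat_rect (fun _ => nat) 0 step k with
      | 0 => forall m, m < k -> exists v, eval f (pair m x) (S v)
      | 1 => True
      | S (S n) => eval f (pair n x) 0 /\
                   forall m, m < n -> exists v, eval f (pair m x) (S v)
      end).
    { induction k as [|k IH]; simpl; [lia|].
      destruct (nat_rect _ 0 step k) as [|u]; simpl; trivial.
      destruct (run f s (pair k x)) as [|[|v]] eqn:Ev; trivial.
      - split; auto.
      - intros m Hm. destruct (Nat.eq_dec m k) as [->|]; [eauto|].
        apply IH. lia. }
    specialize (Hinv s).
    destruct (nat_rect _ 0 step s) as [|[|n]]; try discriminate.
    injection H as <-. destruct Hinv. now constructor.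
Qed.

Lemma run_complete c x y : eval c x y -> exists s, run c s x = S y.
Proof.
  revert x y.
  induction c as [ | | | | |f IHf g IHg|f IHf g IHg|f IHf g IHg|f IHf];
    intros x y H; try (inversion H; exists 0; reflexivity).
  - inversion H as [| | | | |? ? ? a b Ha Hb| | |]; subst.
    destruct (IHf _ _ Ha) as [s1 E1], (IHg _ _ Hb) as [s2 E2].
    exists (max s1 s2). simpl.
    rewrite (run_mono f s1 (max s1 s2) x a), (run_mono g s2 (max s1 s2) x b);
      trivial; lia.
  - inversion H as [| | | | | |? ? ? z ? Hz Hy| |]; subst.
    destruct (IHg _ _ Hz) as [s1 E1], (IHf _ _ Hy) as [s2 E2].
    exists (max s1 s2). simpl.
    rewrite (run_mono g s1 (max s1 s2) x z) by (trivial; lia).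
    apply (run_mono f s2); trivial; lia.
  - inversion H as [| | | | | | |? ? ? ? Hr|]; subst. clear H. simpl.
    revert y Hr. induction (unpair1 x) as [|n IH]; intros y H.
    + inversion H; subst. apply IHf. assumption.
    + inversion H as [|? ? ? ? r ? Hr Hy]; subst.
      destruct (IH _ Hr) as [s1 E1], (IHg _ _ Hy) as [s2 E2].
      exists (max s1 s2). simpl.
      (* The recursion up to [n] is itself a run of [PRec f g], at [n] with the same parameter, so
         monotonicity applies to it. *)
      assert (Hm := run_mono (PRec f g) s1 (max s1 s2) (pair n (unpair2 x)) r).
      simpl in Hm. autorewrite with unpair in Hm. rewrite Hm by (trivial; lia).
      apply (run_mono g s2); trivial; lia.
  - inversion H as [| | | | | | | |? ? ? H0 Hpos]; subst.
    (* One amount of fuel has to serve all arguments below the zero at once; maxima provide it. *)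
    assert (Hfuel : forall k, k <= y -> exists s, forall m, m < k ->
      exists v, run f s (pair m x) = S (S v)).
    { induction k as [|k IH]; intros Hk; [exists 0; lia|].
      destruct IH as [s1 H1']; [lia|].
      destruct (Hpos k Hk) as [v Hv]. destruct (IHf _ _ Hv) as [s2 E2].
      exists (max s1 s2). intros m Hm.
      destruct (Nat.eq_dec m k) as [->|].
      - exists v. apply (run_mono f s2); trivial; lia.
      - destruct (H1' m) as [w Hw]; [lia|].
        exists w. apply (run_mono f s1); trivial; lia. }
    destruct (Hfuel y (le_n y)) as [s1 H1']. destruct (IHf _ _ H0) as [s2 E2].
    (* The argument [y] is examined in round [S y], so at least that many rounds are required. *)
    set (s := max (S y) (max s1 s2)). exists s. simpl.
    match goal with |- pred (nat_rect _ _ ?st _) = _ => set (step := st) end.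
    assert (Hbefore : forall k, k <= y -> nat_rect (fun _ => nat) 0 step k = 0).
    { induction k as [|k IH]; simpl; intros Hk; trivial.
      rewrite IH by lia. simpl.
      destruct (H1' k Hk) as [v Hv].
      now rewrite (run_mono f s1 s _ _ ltac:(lia) Hv). }
    assert (Hafter : forall d, nat_rect (fun _ => nat) 0 step (d + S y) = S (S y)).
    { induction d as [|d IH]; simpl.
      - rewrite Hbefore by lia. simpl.
        now rewrite (run_mono f s2 s _ _ ltac:(lia) E2).
      - now rewrite IH. }
    specialize (Hafter (s - S y)).
    replace (s - S y + S y) with s in Hafter by lia. now rewrite Hafter.
Qed.

(** [run] is a function, so two results can be compared at a common amount of fuel, without an
    induction on the mutual relations [eval] and [eval_rec]. *)
Lemma eval_det c x y z : eval c x y -> eval c x z -> y = z.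
Proof.
  intros [s Hs]%run_complete [t Ht]%run_complete.
  apply (run_mono c s (max s t)) in Hs; [|lia].
  apply (run_mono c t (max s t)) in Ht; [|lia]. congruence.
Qed.

(** * Computably enumerable sets *)

(** Kleene's normal form. Forwards, the witness [w] is the fuel of a successful run; backwards,
    [PMu] searches for the least zero, and totality of [h] keeps the search from getting stuck
    before it. *)
Lemma ce_set_normal_form (A : nat -> Prop) :
  ce_set A <->
  exists h, computable_fun2 h /\ forall x, A x <-> exists w, h w x = 0.
Proof.
  split.
  - intros [c Hc].
    exists (fun s x => match run c s x with 0 => 1 | S _ => 0 end). split.
    + pose proof (computable_run c). computable.
    + intros x. rewrite Hc. split.
      * intros [y Hy]. destruct (run_complete _ _ _ Hy) as [s Hs].
        exists s. now rewrite Hs.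
      * intros [s Hs]. destruct (run c s x) as [|y] eqn:E; [discriminate|].
        exists y. eapply run_sound; eauto.
  - intros (h & [c Hc] & HA). exists (PMu c). intros x. rewrite HA.
    assert (Hcp : forall w, eval c (pair w x) (h w x)).
    { intros w. specialize (Hc (pair w x)). now autorewrite with unpair in Hc. }
    split.
    + intros Hw.
      destruct (dec_inh_nat_subset_has_unique_least_element (fun w => h w x = 0))
        as (w & [Hw0 Hmin] & _); trivial.
      { intros w. destruct (Nat.eq_dec (h w x) 0); auto. }
      exists w. constructor.
      * rewrite <- Hw0. apply Hcp.
      * intros m Hm. exists (pred (h m x)).
        replace (S (pred (h m x))) with (h m x); [apply Hcp|].
        destruct (h m x) eqn:E; trivial. apply Hmin in E. lia.
    + intros [w Hw]. inversion Hw; subst. exists w. eapply eval_det; eauto.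
Qed.

Lemma ce_ext (A B : nat -> Prop) : (forall x, A x <-> B x) -> ce_set A -> ce_set B.
Proof. intros H [c Hc]. exists c. intros x. now rewrite <- H. Qed.

Lemma ce_comp (A : nat -> Prop) f :
  ce_set A -> computable_fun f -> ce_set (fun x => A (f x)).
Proof.
  rewrite !ce_set_normal_form. intros (h & Hh & HA) Hf.
  exists (fun w x => h w (f x)). split; [computable | auto].
Qed.

Lemma ce_rel_comp (R : nat -> nat -> Prop) f g :
  ce_rel R -> computable_fun f -> computable_fun g -> ce_set (fun x => R (f x) (g x)).
Proof.
  intros HR Hf Hg.
  apply ce_ext with
    (fun x => (fun p => R (unpair1 p) (unpair2 p)) (pair (f x) (g x))).
  - intros x. now autorewrite with unpair.
  - apply (ce_comp (fun p => R (unpair1 p) (unpair2 p))); computable.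
Qed.

Lemma ce_and (A B : nat -> Prop) :
  ce_set A -> ce_set B -> ce_set (fun x => A x /\ B x).
Proof.
  rewrite !ce_set_normal_form. intros (h & Hh & HA) (k & Hk & HB).
  exists (fun w x => match h (unpair1 w) x with
                     | 0 => k (unpair2 w) x
                     | S _ => 1
                     end). split; [computable|].
  intros x. rewrite HA, HB. split.
  - intros [[v Hv] [w Hw]]. exists (pair v w). autorewrite with unpair.
    now rewrite Hv.
  - intros [w Hw]. destruct (h (unpair1 w) x) eqn:E; [eauto | discriminate].
Qed.

Lemma ce_or (A B : nat -> Prop) :
  ce_set A -> ce_set B -> ce_set (fun x => A x \/ B x).
Proof.
  rewrite !ce_set_normal_form. intros (h & Hh & HA) (k & Hk & HB).
  exists (fun w x => match h w x with 0 => 0 | S _ => k w x end).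
  split; [computable|].
  intros x. rewrite HA, HB. split.
  - intros [[w Hw]|[w Hw]]; exists w; rewrite Hw; trivial.
    now destruct (h w x).
  - intros [w Hw]. destruct (h w x) eqn:E; eauto.
Qed.

Lemma ce_ex (P : nat -> nat -> Prop) :
  ce_rel P -> ce_set (fun x => exists y, P y x).
Proof.
  unfold ce_rel. rewrite !ce_set_normal_form. intros (h & Hh & HP).
  exists (fun w x => h (unpair1 w) (pair (unpair2 w) x)). split; [computable|].
  intros x. split.
  - intros [y Hy]. specialize (HP (pair y x)). autorewrite with unpair in HP.
    apply HP in Hy as [w Hw]. exists (pair w y). now autorewrite with unpair.
  - intros [w Hw]. exists (unpair2 w).
    specialize (HP (pair (unpair2 w) x)). autorewrite with unpair in HP.
    apply HP. eauto.
Qed.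

Lemma ce_eq f g : computable_fun f -> computable_fun g -> ce_set (fun x => f x = g x).
Proof.
  intros Hf Hg. pose proof (computable_eqb f g Hf Hg) as He.
  unfold computable_bool in He. apply ce_set_normal_form.
  exists (fun _ x => match Nat.b2n (f x =? g x) with 0 => 1 | S _ => 0 end).
  split.
  { computable.
    apply (computable_comp (fun x => Nat.b2n (f x =? g x)) (fun p => unpair2 p));
      computable. }
  intros x. rewrite <- Nat.eqb_eq. destruct (f x =? g x); simpl; split.
  - now exists 0.
  - trivial.
  - discriminate.
  - now intros [? [=]].
Qed.

Lemma computable_set_ce (A : nat -> Prop) :
  computable_set A -> ce_set A /\ ce_set (fun x => ~ A x).
Proof.
  intros [c Hc]. pose proof (computable_run c) as Hrun.
  assert (Hev : forall y, ce_set (fun x => eval c x y)).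
  { intros y. apply ce_ext with (fun x => exists s, run c s x = S y).
    - intros x. split; [intros [s Hs]; eapply run_sound; eauto | apply run_complete].
    - apply (ce_ex (fun s x => run c s x = S y)). apply ce_eq; computable. }
  split; [apply (ce_ext (fun x => eval c x 1)) | apply (ce_ext (fun x => eval c x 0))];
    trivial; intros x; destruct (Hc x) as [H1 H0]; split; trivial; intros H.
  - apply NNPP. intros HA. discriminate (eval_det _ _ _ _ H (H0 HA)).
  - intros HA. discriminate (eval_det _ _ _ _ H (H1 HA)).
Qed.

(** * Well-orders multiplied by ω *)

(** Applied to two-element sets, the minimum clause yields totality. *)
Definition strict_well_order (lt : nat -> nat -> Prop) : Prop :=
  (forall a, ~ lt a a) /\
  (forall a b c, lt a b -> lt b c -> lt a c) /\
  (forall S : nat -> Prop, (exists a, S a) ->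
     exists m, S m /\ forall a, S a -> m = a \/ lt m a).

Lemma nat_least (P : nat -> Prop) :
  (exists n, P n) -> exists n, P n /\ forall m, P m -> n <= m.
Proof.
  intros HP.
  destruct (dec_inh_nat_subset_has_unique_least_element P) as (n & Hn & _);
    eauto using classic.
Qed.

(* Replacing every element of an order of type β by a copy of ω gives order type ω·β, in
   which the pair of [p] and [b] sits at λ + b with λ zero or limit. *)
Definition omega_lex (lt : nat -> nat -> Prop) (m n : nat) : Prop :=
  lt (unpair1 m) (unpair1 n) \/
  (unpair1 m = unpair1 n /\ unpair2 m <= unpair2 n).

Lemma omega_lex_well_order lt :
  strict_well_order lt -> well_order_on (in_dom None) (omega_lex lt).
Proof.
  intros (Hirr & Htr & Hmin). unfold omega_lex. repeat split.
  - auto.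
  - intros a b _ _ [H1|[H1 H1']] [H2|[H2 H2']].
    + destruct (Hirr (unpair1 a)). eauto.
    + rewrite H2 in H1. now apply Hirr in H1.
    + rewrite H1 in H2. now apply Hirr in H2.
    + apply unpair_inj; trivial. lia.
  - intros a b c _ _ _ [H1|[H1 H1']] [H2|[H2 H2']].
    + eauto.
    + rewrite <- H2. auto.
    + rewrite H1. auto.
    + right. split; [congruence | lia].
  - intros a b _ _.
    destruct (Hmin (fun p => p = unpair1 a \/ p = unpair1 b)) as (m & Hm & Hle); eauto.
    destruct (Hle (unpair1 a)) as [Ea|La]; auto;
      destruct (Hle (unpair1 b)) as [Eb|Lb]; auto.
    + assert (unpair1 a = unpair1 b) by congruence. lia.
    + subst. auto.
    + subst. auto.
    + destruct Hm as [->| ->]; exfalso; eapply Hirr; eauto.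
  - intros S _ [a0 Ha0].
    destruct (Hmin (fun p => exists b, S (pair p b))) as (p & Hp & Hpmin).
    { exists (unpair1 a0), (unpair2 a0). now rewrite pair_unpair. }
    destruct (nat_least _ Hp) as (b & Hb & Hbmin).
    exists (pair p b). split; trivial. intros a Ha. autorewrite with unpair.
    rewrite <- (pair_unpair a) in Ha.
    destruct (Hpmin (unpair1 a)) as [E|L]; eauto.
    right. split; trivial. apply Hbmin. now rewrite E.
Qed.

(** Consecutive places lie in the same copy of ω: if [p] is in a later copy, the place after [q] in
    its own copy already lies between them. *)
Lemma omega_lex_imm_pred lt q p :
  strict_well_order lt ->
  imm_pred (in_dom None) (omega_lex lt) q p <->
  unpair1 q = unpair1 p /\ unpair2 p = S (unpair2 q).
Proof.
  intros (Hirr & Htr & _). unfold imm_pred, lt_on, omega_lex; simpl. split.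
  - intros [(_ & _ & Hle & Hne) Hno].
    set (r := pair (unpair1 q) (S (unpair2 q))).
    destruct (Nat.eq_dec r p) as [<-|Hrp].
    { unfold r. now autorewrite with unpair. }
    destruct Hno. exists r. split.
    + repeat split; trivial.
      * right. unfold r. autorewrite with unpair. lia.
      * intros E. apply (f_equal unpair2) in E. unfold r in E.
        autorewrite with unpair in E. lia.
    + repeat split; trivial. unfold r in *. autorewrite with unpair.
      destruct Hle as [Hlt|[E Hle]]; [auto|]. right. split; trivial.
      assert (unpair2 q <> unpair2 p) by (intros E'; now apply Hne, unpair_inj).
      lia.
  - intros [H1 H2]. split.
    + repeat split; trivial.
      * right. split; trivial. lia.
      * intros ->. lia.
    + intros (r & (_ & _ & Hqr & Nqr) & (_ & _ & Hrp & Nrp)).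
      rewrite <- H1 in *.
      destruct Hqr as [Lqr|[Eqr Lqr]], Hrp as [Lrp|[Erp Lrp]].
      * eapply Hirr; eauto.
      * rewrite Erp in Lqr. eapply Hirr; eauto.
      * rewrite Eqr in Lrp. eapply Hirr; eauto.
      * destruct (Nat.eq_dec (unpair2 q) (unpair2 r)).
        -- now apply Nqr, unpair_inj.
        -- apply Nrp, unpair_inj; [congruence | lia].
Qed.

Lemma omega_lex_fin_part lt p n :
  strict_well_order lt ->
  fin_part (in_dom None) (omega_lex lt) p n <-> n = unpair2 p.
Proof.
  intros Hwo. split.
  - intros H. induction H as [p _ Hno|q p n Hqp _ IH].
    + destruct (unpair2 p) as [|b] eqn:E; trivial. destruct Hno.
      exists (pair (unpair1 p) b). rewrite omega_lex_imm_pred by trivial.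
      now autorewrite with unpair.
    + apply omega_lex_imm_pred in Hqp as [_ E]; trivial. congruence.
  - intros ->. remember (unpair2 p) as b eqn:E. revert p E.
    induction b as [|b IH]; intros p E.
    + constructor; [exact I|]. intros [q Hq].
      apply omega_lex_imm_pred in Hq as [_ H]; trivial. lia.
    + apply fp_step with (pair (unpair1 p) b).
      * rewrite omega_lex_imm_pred by trivial. now autorewrite with unpair.
      * apply IH. now autorewrite with unpair.
Qed.

(** Every place has a later one in its copy of ω, so there is no maximum: the order type is a limit,
    hence even, and the places of the other parity are the odd ones. *)
Lemma omega_lex_parity_differs lt p :
  strict_well_order lt ->
  parity_differs (in_dom None) (omega_lex lt) p <-> Nat.odd (unpair2 p) = true.
Proof.
  intros Hwo. unfold parity_differs.
  assert (Hty : forall n, fin_part_type (in_dom None) (omega_lex lt) n <-> n = 0).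
  { assert (Hnomax : ~ exists m, in_dom None m /\
      forall a, in_dom None a -> omega_lex lt a m).
    { intros (m & _ & Hm). specialize (Hm (pair (unpair1 m) (S (unpair2 m))) I).
      unfold omega_lex in Hm. autorewrite with unpair in Hm.
      destruct Hwo as [Hirr _]. destruct Hm as [Hm|]; [now apply Hirr in Hm | lia]. }
    intros n. unfold fin_part_type. split; [|tauto].
    intros [(m & k & Hm & Hmax & _)|[_ ->]]; trivial.
    destruct Hnomax. eauto. }
  rewrite <- Nat.negb_even. split.
  - intros (_ & n & m & Hn & Hm & Hne).
    apply omega_lex_fin_part in Hn; trivial. apply Hty in Hm. subst. simpl in Hne.
    now destruct (Nat.even _).
  - intros E. split; [exact I|]. exists (unpair2 p), 0. repeat split.
    + now apply omega_lex_fin_part.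
    + now apply Hty.
    + simpl. now destruct (Nat.even _).
Qed.

(** * The Kleene-Brouwer order of a well-founded tree *)

(* Strict Kleene-Brouwer order: extensions come before their prefixes. *)
Fixpoint kb (l l' : list nat) : bool :=
  match l, l' with
  | nil, _ => false
  | _ :: _, nil => true
  | a :: l, b :: l' => (a <? b) || ((a =? b) && kb l l')
  end.

Lemma kb_cons a b l l' :
  kb (a :: l) (b :: l') = true <-> a < b \/ a = b /\ kb l l' = true.
Proof.
  simpl. now rewrite orb_true_iff, andb_true_iff, Nat.ltb_lt, Nat.eqb_eq.
Qed.

Lemma kb_irrefl l : kb l l = false.
Proof.
  induction l as [|a l IH]; simpl; trivial.
  now rewrite Nat.ltb_irrefl, IH, andb_false_r.
Qed.

Lemma kb_trans l l' l'' : kb l l' = true -> kb l' l'' = true -> kb l l'' = true.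
Proof.
  revert l' l''. induction l as [|a l IH]; intros [|b l'] [|c l'']; try easy.
  rewrite !kb_cons. intros [H1|[-> H1]] [H2|[-> H2]]; eauto; left; lia.
Qed.

Lemma kb_total l l' : kb l l' = false -> kb l' l = true \/ l = l'.
Proof.
  revert l'. induction l as [|a l IH]; intros [|b l'] H; auto; try easy.
  rewrite kb_cons. rewrite <- not_true_iff_false, kb_cons in H.
  destruct (Nat.lt_total a b) as [L|[<-|L]]; try tauto.
  destruct (IH l') as [E| ->]; auto.
  apply not_true_iff_false. tauto.
Qed.

Lemma kb_app_lt l a : kb (l ++ a :: nil) l = true.
Proof. induction l as [|b l IH]; trivial. apply kb_cons. auto. Qed.

(* A tree is given by its transition function [next] on states, [0] being the state of the
   sequences off the tree. *)
Definition successor (next : nat -> nat -> nat) (st' st : nat) : Prop :=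
  st' <> 0 /\ exists a, st' = next st a.

Lemma fold_left_dead (next : nat -> nat -> nat) l :
  (forall a, next 0 a = 0) -> fold_left next l 0 = 0.
Proof. intros H. induction l as [|a l IH]; simpl; trivial. now rewrite H. Qed.

(** Induction along the tree: if [S] has a non-empty member, take the least first entry [a] that
    occurs and a minimum in the subtree above [a]. Otherwise [nil] is the only member. *)
Lemma kb_min next st (S : list nat -> Prop) :
  (forall a, next 0 a = 0) ->
  Acc (successor next) st ->
  (forall l, S l -> fold_left next l st <> 0) -> (exists l, S l) ->
  exists m, S m /\ forall l, S l -> kb l m = false.
Proof.
  intros H0 Hacc. revert S.
  induction Hacc as [st _ IH]. intros S Hlive [l0 Hl0].
  destruct (classic (exists a l, S (a :: l))) as [Ha|Hno].
  - apply nat_least in Ha as (a & [l1 Hl1] & Hmin).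
    destruct (IH (next st a)) with (S := fun l => S (a :: l)) as (m & Hm & Hmmin).
    (* State [0] is absorbing, so a first entry leading to it could not begin a member of [S]. *)
    + split; eauto. intros E. apply (Hlive _ Hl1). simpl. rewrite E.
      now apply fold_left_dead.
    + intros l Hl. apply (Hlive _ Hl).
    + eauto.
    + exists (a :: m). split; trivial. intros [|b l] Hl; trivial.
      rewrite <- not_true_iff_false, kb_cons.
      intros [L|[-> L]].
      * assert (a <= b) by eauto. lia.
      * now rewrite (Hmmin _ Hl) in L.
  - exists nil. destruct l0 as [|b l0]; [|destruct Hno; eauto].
    split; trivial. intros [|b l] Hl; trivial. destruct Hno; eauto.
Qed.

(** * Computing with coded sequences *)

(** This coding is a bijection between lists and ℕ, so an order on lists becomes an order on all
    numbers. *)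
Fixpoint code (l : list nat) : nat :=
  match l with nil => 0 | a :: l => S (pair a (code l)) end.

(** The code of a tail is smaller than the code of the list, so a code is enough fuel for its own
    decoding. *)
Fixpoint decode_fuel (k s : nat) : list nat :=
  match k, s with
  | S k, S u => unpair1 u :: decode_fuel k (unpair2 u)
  | _, _ => nil
  end.

Definition decode (s : nat) : list nat := decode_fuel s s.

Lemma code_decode s : code (decode s) = s.
Proof.
  enough (H : forall k s, s <= k -> code (decode_fuel k s) = s) by now apply H.
  clear s.
  induction k as [|k IH]; intros [|u] H; simpl; trivial; try lia.
  rewrite IH, pair_unpair; trivial. pose proof (unpair2_le u). lia.
Qed.

Lemma code_inj l l' : code l = code l' -> l = l'.
Proof.
  revert l'. induction l as [|a l IH]; intros [|b l'] H; simpl in H; try easy.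
  injection H as H. f_equal.
  - apply (f_equal unpair1) in H. now autorewrite with unpair in H.
  - apply IH. apply (f_equal unpair2) in H. now autorewrite with unpair in H.
Qed.

Lemma decode_code l : decode (code l) = l.
Proof. apply code_inj, code_decode. Qed.

Lemma length_le_code l : length l <= code l.
Proof.
  induction l as [|a l IH]; simpl; trivial. pose proof (le_pair_r a (code l)). lia.
Qed.

(** The fold is iterated on pairs of a current state and the code of the remaining list. The pair is
    left unchanged once the list is empty, so the code, which bounds the length, may serve as number
    of rounds. *)
Lemma computable_fold_left next st :
  computable_fun2 next -> computable_fun (fun s => fold_left next (decode s) st).
Proof.
  intros Hnext.
  set (step p := match unpair2 p with
                 | 0 => p
                 | S u => pair (next (unpair1 p) (unpair1 u)) (unpair2 u)
                 end).
  assert (Hiter : forall n l st, length l <= n ->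
    Nat.iter n step (pair st (code l)) = pair (fold_left next l st) 0).
  { induction n as [|n IH]; intros [|a l] st' Hn; simpl in Hn; try lia; trivial;
      rewrite Nat.iter_succ_r; unfold step at 2; autorewrite with unpair; simpl.
    - apply (IH nil). simpl. lia.
    - autorewrite with unpair. apply IH. lia. }
  apply computable_ext with (fun s => unpair1 (Nat.iter s step (pair st s))).
  - intros s. rewrite <- (code_decode s) at 2.
    rewrite Hiter by (rewrite <- (code_decode s) at 2; apply length_le_code).
    now autorewrite with unpair.
  - apply computable_unpair1, computable_iter; unfold step; computable.
Qed.

Lemma computable_kb f g :
  computable_fun f -> computable_fun g ->
  computable_bool (fun x => kb (decode (f x)) (decode (g x))).
Proof.
  intros Hf Hg.
  (* states [0] and [1] are the answers, [S (S (pair s t))] still has to compare [s] and [t] *)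
  set (step st := match st with
    | 0 => 0
    | S r => match r with
      | 0 => 1
      | S q => match unpair1 q with
        | 0 => 0
        | S u => match unpair2 q with
          | 0 => 1
          | S v => if unpair1 u <? unpair1 v then 1
                   else if unpair1 u =? unpair1 v
                        then S (S (pair (unpair2 u) (unpair2 v))) else 0
          end
        end
      end
    end).
  assert (Hstep : computable_fun step).
  { unfold step. computable.
    apply computable_if; [apply computable_ltb; computable | computable |].
    apply computable_if; [apply computable_eqb; computable | computable | computable]. }
  assert (Hdone : forall n b, Nat.iter n step (Nat.b2n b) = Nat.b2n b).
  { induction n as [|n IH]; intros b; simpl; trivial. rewrite IH. now destruct b. }
  (* Each round consumes an entry or answers; one more round than the length is required to
     recognize the exhausted list. *)
  assert (Hiter : forall l l' n, length l < n ->
    Nat.iter n step (S (S (pair (code l) (code l')))) = Nat.b2n (kb l l')).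
  { induction l as [|a l IH]; intros l' [|n] Hn; simpl in Hn; try lia;
      rewrite Nat.iter_succ_r; unfold step at 2; autorewrite with unpair; simpl.
    - apply (Hdone n false).
    - destruct l' as [|b l']; simpl; autorewrite with unpair.
      + apply (Hdone n true).
      + destruct (a <? b); simpl; [apply (Hdone n true)|].
        destruct (a =? b); simpl; [|apply (Hdone n false)].
        apply IH. lia. }
  apply computable_ext with
    (fun x => Nat.iter (S (f x)) step (S (S (pair (f x) (g x))))).
  - intros x. rewrite <- (code_decode (f x)) at 2. rewrite <- (code_decode (g x)) at 1.
    apply Hiter. rewrite <- (code_decode (f x)) at 2.
    pose proof (length_le_code (decode (f x))). lia.
  - apply computable_iter; computable.
Qed.

(** * Extending the order to all numbers *)

(* Kleene-Brouwer order on the codes satisfying [live], preceded by the other numbers in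
   their natural order, so that all of ℕ is ordered. *)
Definition live_kb (live : nat -> bool) (s t : nat) : bool :=
  if live s then live t && kb (decode s) (decode t) else live t || (s <? t).

(** A set containing dead numbers has its least dead number as minimum, since these come first; any
    other set consists of live codes and falls under the hypothesis. *)
Lemma live_kb_well_order live :
  (forall S : list nat -> Prop, (forall l, S l -> live (code l) = true) ->
     (exists l, S l) -> exists m, S m /\ forall l, S l -> kb l m = false) ->
  strict_well_order (fun s t => live_kb live s t = true).
Proof.
  intros Hkb. unfold live_kb. split; [|split].
  - intros a. destruct (live a); simpl; [now rewrite kb_irrefl | now rewrite Nat.ltb_irrefl].
  - intros a b c. destruct (live a), (live b), (live c); simpl; trivial; try easy.
    + apply kb_trans.
    + rewrite !Nat.ltb_lt. lia.
  - intros S [a0 Ha0].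
    destruct (classic (exists a, S a /\ live a = false)) as [Hdead|Hlive].
    + apply nat_least in Hdead as (m & [Hm E] & Hmin).
      exists m. split; trivial. intros a Ha. rewrite E.
      destruct (live a) eqn:Ea; auto. simpl.
      rewrite Nat.ltb_lt. assert (m <= a) by auto. lia.
    + assert (Hall : forall a, S a -> live a = true).
      { intros a Ha. apply not_false_iff_true. eauto. }
      destruct (Hkb (fun l => S (code l))) as (m & Hm & Hmin); auto.
      { exists (decode a0). now rewrite code_decode. }
      exists (code m). split; trivial. intros a Ha.
      rewrite (Hall _ Hm), (Hall _ Ha), decode_code. simpl.
      rewrite <- (code_decode a) in Ha. apply Hmin, kb_total in Ha as [Ha|<-]; auto.
      left. apply code_decode.
Qed.

Lemma computable_live_kb live f g :
  computable_bool live -> computable_fun f -> computable_fun g ->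
  computable_bool (fun x => live_kb live (f x) (g x)).
Proof.
  intros Hlive Hf Hg. unfold computable_bool, live_kb.
  assert (computable_bool (fun x => live (f x)))
    by (apply (computable_comp (fun s => Nat.b2n (live s))); trivial).
  assert (computable_bool (fun x => live (g x)))
    by (apply (computable_comp (fun s => Nat.b2n (live s))); trivial).
  apply computable_ext with (fun x =>
    if live (f x) then Nat.b2n (live (g x) && kb (decode (f x)) (decode (g x)))
    else Nat.b2n (live (g x) || (f x <? g x))).
  - intros x. now destruct (live (f x)).
  - apply computable_if; trivial.
    + apply computable_andb; trivial. now apply computable_kb.
    + apply computable_orb; trivial. now apply computable_ltb.
Qed.

(** * The tree of chains of basic open sets *)

(** An inaccessible element has an inaccessible element below it; choosing one repeatedly gives the
    descending sequence. *)
Lemma not_Acc_chain {A : Type} (R : A -> A -> Prop) (a : A) :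
  ~ Acc R a -> exists f : nat -> A, f 0 = a /\ forall n, R (f (S n)) (f n).
Proof.
  intros Ha.
  (* The premise sits under the existential so that choice yields a total function [next]. *)
  assert (Hstep : forall x, exists y, ~ Acc R x -> R y x /\ ~ Acc R y).
  { intros x. destruct (classic (Acc R x)) as [Hx|Hx]; [exists x; tauto|].
    apply NNPP. intros Hno. apply Hx. constructor. intros y Hy.
    apply NNPP. intros Hy'. apply Hno. exists y. auto. }
  set (next x := proj1_sig (constructive_indefinite_description _ (Hstep x))).
  assert (Hnext : forall x, ~ Acc R x -> R (next x) x /\ ~ Acc R (next x)).
  { intros x. exact (proj2_sig (constructive_indefinite_description _ (Hstep x))). }
  set (f := fix f n := match n with 0 => a | S n => next (f n) end).
  assert (Hf : forall n, ~ Acc R (f n)).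
  { induction n as [|n IH]; trivial. simpl. now apply Hnext. }
  exists f. split; trivial. intros n. simpl. now apply Hnext.
Qed.

(* Transitions of the tree of chains O_(i_0) << O_(i_1) << … with O_(i_(m+1)) ⊆ Z_m. State
   [1] is the root, [S (S (pair m i))] stands for the chains with i_m = i; an entry of a
   sequence pairs the next index with a witness, which makes the tree computable. *)
Definition chain_next (h : nat -> nat -> nat) (st a : nat) : nat :=
  match st with
  | 0 => 0
  | S t => match t with
    | 0 => S (S (pair 0 a))
    | S q => match h (unpair2 a) (pair (unpair1 q) (pair (unpair2 q) (unpair1 a))) with
      | 0 => S (S (pair (S (unpair1 q)) (unpair1 a)))
      | S _ => 0
      end
    end
  end.

Lemma computable_chain_next h : computable_fun2 h -> computable_fun2 (chain_next h).
Proof. intros Hh. unfold chain_next. computable. Qed.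

Definition enum_open {E : Type} (O : nat -> E -> Prop) (I : nat -> Prop) (x : E) : Prop :=
  exists i, I i /\ O i x.

(** A basic set inside both given ones is approximated around [x], and monotonicity of [ll] carries
    this to the larger sets. This is what extends a chain ending at [i] into an open set containing
    [O j]. *)
Lemma approximation_refine {E : Type} (O : nat -> E -> Prop) ll i j x :
  is_basis O -> approximation_relation O ll -> O i x -> O j x ->
  exists k, O k x /\ ll (O i) (O k) /\ ll (O j) (O k).
Proof.
  intros [_ Hb] (_ & Hmon & Hex & _) Hi Hj.
  destruct (Hb i j x Hi Hj) as (t & Ht & Hti & Htj).
  destruct (Hex t x Ht) as (k & Hk & Htk). eauto 6.
Qed.

Lemma alternating_chains_D_union {E : Type} (O : nat -> E -> Prop) ll
    (Z : nat -> nat -> Prop) (A : E -> Prop) :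
  effective_approximation_space E O ll -> ce_rel Z ->
  (forall x, A x <-> forall m, Nat.odd m = false -> enum_open O (Z m) x) ->
  (forall x, ~ A x <-> forall m, Nat.odd m = true -> enum_open O (Z m) x) ->
  D_union O A.
Proof.
  intros (Hbasis & Happ & Hll) HZ HA HnA.
  (* Inclusion of [O k] in the open set [Z m] need not be c.e.; it is replaced by [ll (O j) (O k)]
     for some [j] listed in [Z m], which is c.e. and implies it. *)
  set (Q p := let m := unpair1 p in let i := unpair1 (unpair2 p) in
              let k := unpair2 (unpair2 p) in
              ll (O i) (O k) /\ exists j, Z m j /\ ll (O j) (O k)).
  assert (HQ : ce_set Q).
  { apply ce_and.
    - apply (ce_rel_comp (fun i j => ll (O i) (O j))); computable.
    - apply (ce_ex (fun j p => Z (unpair1 p) j /\ ll (O j) (O (unpair2 (unpair2 p))))).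
      apply ce_and.
      + apply ce_rel_comp; computable.
      + apply (ce_rel_comp (fun i j => ll (O i) (O j))); computable. }
  apply ce_set_normal_form in HQ as (h & Hh & HQ).
  set (next := chain_next h).
  set (state s := fold_left next (decode s) 1).
  set (live s := negb (state s =? 0)).
  assert (Hlive : forall s, live s = true <-> state s <> 0).
  { intros s. unfold live. now rewrite negb_true_iff, Nat.eqb_neq. }
  assert (Hstep : forall m i k w,
    h w (pair m (pair i k)) = 0 -> ll (O i) (O k) /\ subset (O k) (enum_open O (Z m))).
  { intros m i k w Hw. destruct (HQ (pair m (pair i k))) as [_ H].
    unfold Q in H. autorewrite with unpair in H.
    destruct H as (H1 & j & Hj & H2); eauto. split; trivial.
    intros x Hx. exists j. split; trivial. now apply (proj1 Happ) in H2; auto. }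
  assert (Hacc : Acc (successor next) 1).
  { apply NNPP. intros Hno. apply not_Acc_chain in Hno as (f & Hf0 & Hf).
    (* The branch starts at the root, so indices begin at [f 1]; the two predecessors undo the
       encoding [S (S (pair n i))] of states. *)
    set (u n := unpair2 (pred (pred (f (S n))))).
    assert (Hfu : forall n, f (S n) = S (S (pair n (u n)))).
    { induction n as [|n IH].
      - destruct (Hf 0) as [_ [a Ha]]. rewrite Hf0 in Ha. unfold u. rewrite Ha.
        simpl. now autorewrite with unpair.
      - destruct (Hf (S n)) as [Hne [a Ha]]. rewrite IH in Ha. simpl in Ha.
        autorewrite with unpair in Ha.
        unfold u. destruct (h _ _); [|congruence].
        rewrite Ha. simpl. now autorewrite with unpair. }
    assert (Hu : forall n, ll (O (u n)) (O (u (S n))) /\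
                           subset (O (u (S n))) (enum_open O (Z n))).
    { intros n. destruct (Hf (S n)) as [Hne [a Ha]].
      rewrite !Hfu in Ha. simpl in Ha. autorewrite with unpair in Ha.
      destruct (h _ _) eqn:Eh; [|discriminate].
      injection Ha as Ha. apply (f_equal unpair2) in Ha. autorewrite with unpair in Ha.
      rewrite Ha. eapply Hstep. exact Eh. }
    destruct Happ as (_ & _ & _ & Hlim).
    destruct (Hlim u) as [x Hx]; [apply Hu|].
    assert (HZx : forall n, enum_open O (Z n) x).
    { intros n. apply Hu, Hx. }
    assert (~ A x) as Hx' by (apply HnA; auto).
    apply Hx', HA. auto. }
  set (lt s t := live_kb live s t = true).
  assert (Hwo : strict_well_order lt).
  { apply live_kb_well_order. intros S HS. apply kb_min with next 1; trivial.
    intros l Hl. apply HS in Hl. apply Hlive in Hl. unfold state in Hl.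
    now rewrite decode_code in Hl. }
  assert (Hstate : computable_fun state).
  { apply computable_fold_left. now apply computable_chain_next. }
  assert (Hclive : computable_bool live).
  { apply computable_ext with (fun s => match state s with 0 => 0 | S _ => 1 end).
    - intros s. unfold live. now destruct (state s).
    - computable. }
  (* A chain ending with [m] and [i] puts [O i] at place 0 or 1 of its copy of ω, according to the
     parity of [m]; all other places, and those of the root and of dead codes, stay empty. *)
  set (W n i := exists m, state (unpair1 n) = S (S (pair m i)) /\
                          unpair2 n = Nat.b2n (Nat.odd m)).
  exists None, (omega_lex lt), (fun n => enum_open O (W n)). simpl.
  split; [now exists 0|]. split; [now apply omega_lex_well_order|].
  split; [|split; [|split]].
  - apply computable_set_bool with (fun p =>
      let m := unpair1 p in let n := unpair2 p in
      live_kb live (unpair1 m) (unpair1 n) ||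
      ((unpair1 m =? unpair1 n) && (unpair2 m <=? unpair2 n))).
    + apply computable_orb; [apply computable_live_kb; computable|].
      apply computable_andb; [apply computable_eqb | apply computable_leb]; computable.
    + intros p. unfold omega_lex, lt.
      rewrite orb_true_iff, andb_true_iff, Nat.eqb_eq, Nat.leb_le. tauto.
  - apply computable_set_bool with (fun p => Nat.odd (unpair2 p)).
    + apply computable_odd. computable.
    + intros p. now apply omega_lex_parity_differs.
  - exists W. split; [|reflexivity].
    apply (ce_ex (fun m p => state (unpair1 (unpair1 p)) = S (S (pair m (unpair2 p))) /\
                             unpair2 (unpair1 p) = Nat.b2n (Nat.odd m))).
    apply ce_and; apply ce_eq; computable.
    apply computable_odd. computable.
  - intros x.
    (* Minimality is only asked in the order on sequences, because the competitor that refutes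
       membership in [Z m] is an extension of the sequence at [n]. *)
    assert (Hparity : forall n, enum_open O (W n) x ->
      (forall q, enum_open O (W q) x -> ~ lt (unpair1 q) (unpair1 n)) ->
      A x <-> Nat.odd (unpair2 n) = true).
    { intros n (i & (m & Hn & Hb) & Hi) Hmin.
      (* If [x] were in [Z m], refining around [x] would give one more entry, the index [k] paired
         with its witness [w], and the longer sequence precedes the shorter one. *)
      assert (HZx : ~ enum_open O (Z m) x).
      { intros (j & Hj & Hjx).
        destruct (approximation_refine O ll i j x) as (k & Hk & Hik & Hjk); trivial.
        destruct (HQ (pair m (pair i k))) as [H _]. unfold Q in H.
        autorewrite with unpair in H. destruct H as [w Hw]; eauto.
        set (s := code (decode (unpair1 n) ++ pair k w :: nil)).
        assert (Hs : state s = S (S (pair (S m) k))).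
        { unfold state, s. rewrite decode_code, fold_left_app.
          fold (state (unpair1 n)). rewrite Hn. simpl.
          autorewrite with unpair. now rewrite Hw. }
        apply (Hmin (pair s (Nat.b2n (Nat.odd (S m))))).
        - exists k. split; trivial. exists (S m). now autorewrite with unpair.
        - autorewrite with unpair. unfold lt, live_kb.
          assert (live s = true) as -> by (apply Hlive; congruence).
          assert (live (unpair1 n) = true) as -> by (apply Hlive; congruence).
          unfold s. rewrite decode_code. apply kb_app_lt. }
      replace (Nat.odd (unpair2 n)) with (Nat.odd m)
        by (rewrite Hb; now destruct (Nat.odd m)).
      destruct (Nat.odd m) eqn:Em; split; trivial; try easy.
      - intros _. apply NNPP. intros Hx. apply HZx. now apply HnA.
      - intros Hx. destruct HZx. now apply HA. }
    split.
    + intros Hx.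
      destruct (omega_lex_well_order lt Hwo) as (_ & Hanti & _ & _ & Hmin).
      destruct (Hmin (fun n => enum_open O (W n) x)) as (n & Hn & Hnmin).
      * intros; exact I.
      (* The root reads its entry as a bare index, without a witness, and the one-entry chain has
         [m = 0], hence place 0. *)
      * destruct (proj1 Hbasis x) as [i Hi].
        exists (pair (code (i :: nil)) 0), i. split; trivial. exists 0.
        autorewrite with unpair. unfold state. rewrite decode_code. now split.
      * exists n. rewrite omega_lex_parity_differs by trivial. repeat split; trivial.
        -- apply Hparity; trivial. intros q Hq Hlt.
           assert (q = n) as ->.
           { apply Hanti; try exact I; auto. now left. }
           now apply Hwo in Hlt.
        -- intros (q & (_ & _ & Hle & Hne) & Hq). apply Hne.
           apply Hanti; try exact I; auto.
    + intros (n & Hodd & Hn & Hno).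
      rewrite omega_lex_parity_differs in Hodd by trivial.
      apply (Hparity n); trivial. intros q Hq Hlt. apply Hno. exists q.
      repeat split; trivial; [now left|].
      intros ->. now apply Hwo in Hlt.
Qed.

(** * From effective intersections to the difference hierarchy *)

Lemma Fsigma_Gdelta_D_union {E : Type} (O : nat -> E -> Prop) ll (A : E -> Prop) :
  effective_approximation_space E O ll -> Fsigma O A -> Gdelta O A -> D_union O A.
Proof.
  intros HE (B & (V & (WV & HWV & HV) & HB) & HAB) (U & (WU & HWU & HU) & HA).
  set (Z m i := (exists n, m = n + n /\ WU n i) \/ (exists n, m = S (n + n) /\ WV n i)).
  pose proof computable_add as Hadd.
  assert (HZ : ce_rel Z).
  { apply ce_or.
    - apply (ce_ex (fun n p => unpair1 p = n + n /\ WU n (unpair2 p))).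
      apply ce_and; [apply ce_eq | apply ce_rel_comp]; computable;
        apply (computable_app2 Nat.add); computable.
    - apply (ce_ex (fun n p => unpair1 p = S (n + n) /\ WV n (unpair2 p))).
      apply ce_and; [apply ce_eq | apply ce_rel_comp]; computable;
        apply (computable_app2 Nat.add); computable. }
  assert (Hodd : forall n, Nat.odd (n + n) = false).
  { intros n. rewrite Nat.odd_add. apply xorb_nilpotent. }
  assert (Hodd' : forall n, Nat.odd (S (n + n)) = true).
  { intros n. now rewrite Nat.odd_succ, <- Nat.negb_odd, Hodd. }
  apply (alternating_chains_D_union O ll Z); trivial; intros x.
  - rewrite HA. split.
    + intros H m Hm.
      destruct (Nat.Even_or_Odd m) as [[n ->]|[n ->]].
      * destruct (proj1 (HU n x) (H n)) as (i & Hi & Hx).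
        exists i. split; trivial. left. exists n. split; [lia | trivial].
      * replace (2 * n + 1) with (S (n + n)) in Hm by lia. now rewrite Hodd' in Hm.
    + intros H n. apply HU. destruct (H (n + n) (Hodd n)) as (i & Hi & Hx).
      exists i. split; trivial. destruct Hi as [(k & E1 & Hk)|(k & E1 & Hk)]; [|lia].
      now replace n with k by lia.
  - rewrite HAB. split.
    + intros H%NNPP m Hm. rewrite HB in H.
      destruct (Nat.Even_or_Odd m) as [[n ->]|[n ->]].
      * replace (2 * n) with (n + n) in Hm by lia. now rewrite Hodd in Hm.
      * destruct (proj1 (HV n x) (H n)) as (i & Hi & Hx).
        exists i. split; trivial. right. exists n. split; [lia | trivial].
    + intros H Hno. apply Hno, HB. intros n. apply HV.
      destruct (H (S (n + n)) (Hodd' n)) as (i & Hi & Hx).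
      exists i. split; trivial. destruct Hi as [(k & E1 & Hk)|(k & E1 & Hk)]; [lia|].
      now replace n with k by lia.
Qed.

(** * From the difference hierarchy to the second level *)

(* The complement of a difference is again a union of differences: a point outside [A]
   lies either in no [X p], or in [X p] for a least [p] of the wrong parity. *)
Lemma D_union_Delta02 {E : Type} (O : nat -> E -> Prop) (A : E -> Prop) :
  (forall x, exists n, O n x) -> D_union O A -> Delta02 O A.
Proof.
  intros Hcover (bound & le & X & _ & Hwo & Hle & Hpar & (W & HW & HX) & HA).
  set (D := in_dom bound) in *.
  destruct Hwo as (Hrefl & Hanti & _ & _ & Hmin).
  apply computable_set_ce in Hle as [Hle _].
  apply computable_set_ce in Hpar as [Hpar Hnpar].
  (* By reflexivity, the domain is the diagonal of the computable relation. *)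
  assert (HD : ce_set D).
  { apply ce_ext with (fun a => D a /\ D a /\ le a a).
    - intros a. split; [tauto|]. auto.
    - apply (ce_rel_comp (fun a b => D a /\ D b /\ le a b)); computable. }
  assert (Hlt : ce_rel (lt_on D le)).
  { apply ce_ext with (fun p => (D (unpair1 p) /\ D (unpair2 p) /\
        le (unpair1 p) (unpair2 p)) /\ Nat.b2n (unpair1 p =? unpair2 p) = 0).
    - intros p. unfold lt_on. rewrite <- Nat.eqb_neq.
      destruct (unpair1 p =? unpair2 p); simpl; intuition discriminate.
    - apply ce_and; [exact Hle|]. apply ce_eq; computable.
      apply computable_eqb; computable. }
  assert (HlW : ce_rel (fun p i => exists q, lt_on D le q p /\ W q i)).
  { apply (ce_ex (fun q x => lt_on D le q (unpair1 x) /\ W q (unpair2 x))).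
    apply ce_and; apply ce_rel_comp; computable. }
  assert (HlX : forall p x, (exists q, lt_on D le q p /\ X q x) <->
    exists i, (exists q, lt_on D le q p /\ W q i) /\ O i x).
  { intros p x. split.
    - intros (q & Hq & (i & Hi & Hx)%HX). eauto.
    - intros (i & (q & Hq & Hi) & Hx). exists q. split; trivial. apply HX. eauto. }
  split.
  - exists (fun p x => parity_differs D le p /\ X p x),
      (fun p x => exists q, lt_on D le q p /\ X q x).
    split; [|split].
    + exists (fun p i => parity_differs D le p /\ W p i). split.
      * apply ce_and; [apply (ce_comp (parity_differs D le)) | exact HW]; computable.
      * intros p x. rewrite HX. split.
        -- intros (Hp & i & Hi & Hx). eauto.
        -- intros (i & (Hp & Hi) & Hx). eauto.
    + exists (fun p i => exists q, lt_on D le q p /\ W q i). auto.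
    + intros x. rewrite HA. split; intros (p & H); exists p; tauto.
  - exists (fun x => ~ A x). split; [|intros x; split; [tauto | apply NNPP]].
    (* Index 0 stands for the whole space minus all the [X p], and index [S p] for [X p] minus the
       earlier sets when [p] has the parity of the order type. *)
    set (WX n i := n = 0 \/
      exists p, n = S p /\ D p /\ ~ parity_differs D le p /\ W p i).
    set (WY n i := (n = 0 /\ exists p, D p /\ W p i) \/
      exists p, n = S p /\ exists q, lt_on D le q p /\ W q i).
    exists (fun n => enum_open O (WX n)), (fun n => enum_open O (WY n)).
    split; [|split].
    + exists WX. split; [|reflexivity].
      apply ce_or; [apply ce_eq; computable|].
      apply (ce_ex (fun p x => unpair1 x = S p /\ D p /\
        ~ parity_differs D le p /\ W p (unpair2 x))).
      repeat apply ce_and.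
      * apply ce_eq; computable.
      * apply (ce_comp D); computable.
      * apply (ce_comp (fun p => ~ parity_differs D le p)); computable.
      * apply ce_rel_comp; computable.
    + exists WY. split; [|reflexivity].
      apply ce_or.
      * apply ce_and; [apply ce_eq; computable|].
        apply (ce_ex (fun p x => D p /\ W p (unpair2 x))).
        apply ce_and; [apply (ce_comp D) | apply ce_rel_comp]; computable.
      * apply (ce_ex (fun p x => unpair1 x = S p /\
          exists q, lt_on D le q p /\ W q (unpair2 x))).
        apply ce_and; [apply ce_eq; computable|].
        apply (ce_rel_comp (fun p i => exists q, lt_on D le q p /\ W q i)); computable.
    + intros x. split.
      * intros Hx.
        destruct (classic (exists p, D p /\ X p x)) as [Hp|Hno].
        -- destruct (Hmin (fun p => D p /\ X p x)) as (p & [Dp Xp] & Hpmin);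
             [tauto | trivial |].
           assert (Hfirst : ~ exists q, lt_on D le q p /\ X q x).
           { intros (q & (Dq & _ & Hqp & Hne) & Xq). apply Hne, Hanti; auto. }
           exists (S p). split.
           ++ destruct (proj1 (HX p x) Xp) as (i & Hi & Oi). exists i.
              split; trivial. right. exists p. repeat split; trivial.
              intros Hd. apply Hx, HA. eauto.
           ++ intros (i & [[[=] _]|(p' & [= <-] & Hq)] & Oi).
              apply Hfirst, HlX. eauto.
        -- exists 0. split.
           ++ destruct (Hcover x) as [i Hi]. exists i. split; trivial. now left.
           ++ intros (i & [[_ (p & Dp & Hi)]|(p & [=] & _)] & Oi).
              apply Hno. exists p. split; trivial. apply HX. eauto.
      * intros ([|p] & HnX & HnY) (p' & Hp' & Xp' & Hfirst)%HA.
        -- apply HnY. destruct (proj1 (HX p' x) Xp') as (i & Hi & Oi).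
           exists i. split; trivial. left. split; trivial.
           exists p'. split; trivial. apply Hp'.
        -- destruct HnX as (i & [[=]|(p1 & [= <-] & Dp & Hpar' & Hi)] & Oi).
           assert (Xp : X p x) by (apply HX; eauto).
           assert (Hfirst' : ~ exists q, lt_on D le q p /\ X q x).
           { intros (j & Hj & Oj)%HlX. apply HnY. exists j. split; trivial.
             right. eauto. }
           (* Both [p] and [p'] would be the first place whose set contains [x]; their parities
              differ, so one of them strictly precedes the other. *)
           assert (p <> p') by (intros ->; contradiction).
           destruct (Hmin (fun q => q = p \/ q = p')) as (q & Hq & Hqmin); eauto.
           { intros a [->| ->]; trivial. apply Hp'. }
           assert (Dp' : D p') by apply Hp'.
           destruct Hq as [->| ->].
           ++ apply Hfirst. exists p. unfold lt_on. auto 10.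
           ++ apply Hfirst'. exists p'. unfold lt_on. auto 10.
Qed.

Theorem theorem5p16 (E : Type) (O : nat -> E -> Prop)
    (ll : (E -> Prop) -> (E -> Prop) -> Prop) :
  effective_approximation_space E O ll ->
  (forall A : E -> Prop, Fsigma O A /\ Gdelta O A -> D_union O A) /\
  (forall A : E -> Prop, D_union O A -> Delta02 O A) /\
  ((forall A : E -> Prop, (Fsigma O A /\ Gdelta O A) <-> Delta02 O A) ->
   forall A : E -> Prop, D_union O A <-> Delta02 O A).
Proof.
  intros HE.
  assert (H1 : forall A, Fsigma O A /\ Gdelta O A -> D_union O A).
  { intros A [HF HG]. now apply Fsigma_Gdelta_D_union with ll. }
  assert (H2 : forall A, D_union O A -> Delta02 O A).
  { intros A. apply D_union_Delta02, HE. }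
  split; [|split]; trivial. intros Heq A. split; [apply H2|].
  intros HA. now apply H1, Heq.
Qed.
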